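(* If $h\in\mathbb R[\sigma]$ and $M\models\mathbb R\mathsf{-OVSA}$ is existentially closed, then the induced function $h(x)\colon M\to M$ has the Intermediate Value Property.
   Context: An ordered $\mathbb R$-vector space is a linearly ordered abelian group (with $x<y\Rightarrow x+z<y+z$) which is also an $\mathbb R$-vector space in such a way that multiplication by positive scalars preserves signs. $\mathbb R\mathsf{-OVSA}$ is the theory of (possibly trivial) ordered $\mathbb R$-vector spaces equipped with an $\mathbb R$-linear strictly increasing bijection $\sigma$ and its inverse, in the language $L_{\mathbb R,\sigma}=\{+,0,-,<\}\cup\{\lambda\cdot-:\lambda\in\mathbb R\}\cup\{\sigma,\sigma^{-1}\}$. An element $h=\sum_i\lambda_i\sigma^i$ of the polynomial ring $\mathbb R[\sigma]$ induces on every model the function $h(x)=\sum_i\lambda_i\sigma^i(x)$. $M\models\mathbb R\mathsf{-OVSA}$ is existentially closed if for every quantifier-free $L_{\mathbb R,\sigma}$-formula $\varphi(x,y)$ ($x$, $y$ finite tuples of variables) and every tuple $a$ from $M$, if some $B\models\mathbb R\mathsf{-OVSA}$ with $B\supseteq M$ (as $L_{\mathbb R,\sigma}$-structures) contains a tuple $b$ with $B\models\varphi(a,b)$, then there is a tuple $m$ in $M$ with $M\models\varphi(a,m)$. A function $M\to M$ has the Intermediate Value Property if it maps convex sets to convex sets. *)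

(* Defs.v *)
From mathcomp Require Import all_boot all_order all_algebra.
From mathcomp Require Import all_classical all_reals.
Set Implicit Arguments.
Unset Strict Implicit.
Unset Printing Implicit Defensive.
Import GRing.Theory.
Local Open Scope classical_set_scope.
Local Open Scope ring_scope.

(* Ordered R-vector spaces, possibly trivial.  The order is a bare relation
   because the algebraic hierarchy has no join of modules and total orders. *)
Record orderedVect (R : realType) := {
  ovs_sort :> lmodType R;
  ovs_lt : rel ovs_sort;
  ovs_lt_irr : irreflexive ovs_lt;
  ovs_lt_trans : transitive ovs_lt;
  ovs_lt_total : forall x y, x != y -> ovs_lt x y || ovs_lt y x;
  ovs_lt_add2r : forall x y z, ovs_lt x y -> ovs_lt (x + z) (y + z);
  ovs_scale_gt0 : forall (a : R) x, 0 < a -> ovs_lt 0 x -> ovs_lt 0 (a *: x);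
  ovs_scale_lt0 : forall (a : R) x, 0 < a -> ovs_lt x 0 -> ovs_lt (a *: x) 0
}.

Definition ovs_le (R : realType) (V : orderedVect R) (x y : V) : bool :=
  (x == y) || ovs_lt x y.

Record ROVSA (R : realType) := {
  rovsa_sort :> orderedVect R;
  sigma : {linear rovsa_sort -> rovsa_sort};
  sigmaV : rovsa_sort -> rovsa_sort;
  sigma_lt : {homo sigma : x y / ovs_lt x y};
  sigmaK : cancel sigma sigmaV;
  sigmaVK : cancel sigmaV sigma
}.

(* Terms and quantifier-free formulas of L_{R,sigma}, variables in [X]. *)
Inductive term (R : realType) (X : Type) : Type :=
| TVar of X
| TZero
| TAdd of term R X & term R X
| TOpp of term R X
| TScale of R & term R X
| TSigma of term R X
| TSigmaV of term R X.

Inductive qf_formula (R : realType) (X : Type) : Type :=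
| FEq of term R X & term R X
| FLt of term R X & term R X
| FNot of qf_formula R X
| FAnd of qf_formula R X & qf_formula R X
| FOr of qf_formula R X & qf_formula R X.

Fixpoint eval_term (R : realType) (X : Type) (M : ROVSA R) (e : X -> M)
    (t : term R X) : M :=
  match t with
  | TVar x => e x
  | TZero => 0
  | TAdd t1 t2 => eval_term e t1 + eval_term e t2
  | TOpp t1 => - eval_term e t1
  | TScale a t1 => a *: eval_term e t1
  | TSigma t1 => sigma M (eval_term e t1)
  | TSigmaV t1 => sigmaV (eval_term e t1)
  end.

Fixpoint holds (R : realType) (X : Type) (M : ROVSA R) (e : X -> M)
    (phi : qf_formula R X) : Prop :=
  match phi with
  | FEq t1 t2 => eval_term e t1 = eval_term e t2
  | FLt t1 t2 => ovs_lt (eval_term e t1) (eval_term e t2)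
  | FNot f => ~ holds e f
  | FAnd f g => holds e f /\ holds e g
  | FOr f g => holds e f \/ holds e g
  end.

(* The valuation of (x, y) by the pair of tuples (a, b). *)
Definition valuation (T : Type) (n m : nat) (a : n.-tuple T) (b : m.-tuple T)
    (i : 'I_n + 'I_m) : T :=
  match i with inl j => tnth a j | inr k => tnth b k end.

(* An extension B of M is given by an L_{R,sigma}-embedding of M into B. *)
Record embedding (R : realType) (M B : ROVSA R) := {
  emb_fun :> {linear M -> B};
  emb_inj : injective emb_fun;
  emb_lt : {mono emb_fun : x y / ovs_lt x y};
  emb_sigma : {morph emb_fun : x / sigma M x >-> sigma B x};
  emb_sigmaV : {morph emb_fun : x / sigmaV x >-> sigmaV x}
}.

Definition existentially_closed (R : realType) (M : ROVSA R) : Prop :=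
  forall (n m : nat) (phi : qf_formula R ('I_n + 'I_m)) (a : n.-tuple M),
    (exists (B : ROVSA R) (f : embedding M B) (b : m.-tuple B),
        holds (valuation (map_tuple f a) b) phi) ->
    exists c : m.-tuple M, holds (valuation a c) phi.

Definition induced (R : realType) (M : ROVSA R) (h : {poly R}) (x : M) : M :=
  \sum_(i < size h) h`_i *: iter i (sigma M) x.

(* Convexity in the sense of the order, not of the vector space structure. *)
Definition order_convex (R : realType) (V : orderedVect R) (A : set V) : Prop :=
  forall x y z, A x -> A y -> ovs_le x z -> ovs_le z y -> A z.

Definition has_IVP (R : realType) (V : orderedVect R) (f : V -> V) : Prop :=
  forall A : set V, order_convex A -> order_convex (f @` A).

(* Main.v *)
Require Import Defs.
From HB Require Import structures.
From mathcomp Require Import all_boot all_order all_algebra.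
From mathcomp Require Import all_classical all_reals.
From mathcomp Require Import complex ring lra.

(** Over the reals, [h] is a product of constants, factors [X - a] and quadratic
factors [X^2 - 2aX + (a^2 + b^2)] with [b != 0] ([real_poly_factor]).  Products
of polynomials induce composites of functions ([inducedM]), and the Intermediate
Value Property is stable under composition, so each factor can be treated on its
own.

For a factor [p] and [x < y] in [M], with [z] strictly between the values of [p]
at [x] and [y], existential closedness reduces the problem to finding, in some
extension of [M], an element strictly between [x] and [y] that [p] maps to [z]
([ec_solve]).  There are two cases.

- [p] has no root in the open half-line of positive reals ([X - a] with
  [a <= 0], and the quadratic factors).  Then [p] is strictly increasing on
  every model.  This is clear when the coefficients are nonnegative; in general
  some multiple of [p] by a polynomial with nonnegative coefficients again has
  nonnegative coefficients ([positive_quadratic]).  The extension is then [M]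
  itself, embedded into itself by [p]: this embedding commutes with [sigma], and
  the element [z] of the larger copy solves [p(z) = f(z)] because [f = p].

- [p = X - a] with [a > 0].  A solution [b] of [sigma b = a b + z] generates
  over [M] just the plane of all [m + r b], which is turned into a model by
  choosing the cut that [b] fills in [M].  Such a choice is compatible with
  [sigma] exactly when the cut is invariant under the increasing bijection
  [T m = (sigma m - z) / a], whose fixed points are the solutions of
  [p(m) = z].  At [x] and [y], [T] moves points in opposite directions, so
  iterating [T] or its inverse from one of the two yields an invariant cut
  between them ([invariant_cut], [cut_extP]). *)

Set Implicit Arguments.
Unset Strict Implicit.
Unset Printing Implicit Defensive.
Import Order.TTheory GRing.Theory Num.Theory.
Local Open Scope ring_scope.

(** * Ordered vector spaces *)

Section OrderedVect.
Context {R : realType} {V : orderedVect R}.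
Implicit Types (x y z : V) (a : R).

Lemma ovs_lt_subr x y : ovs_lt x y = ovs_lt 0 (y - x).
Proof.
apply/idP/idP => [/(@ovs_lt_add2r _ V _ _ (- x))|/(@ovs_lt_add2r _ V _ _ x)].
  by rewrite subrr.
by rewrite add0r subrK.
Qed.

Lemma ovs_le_subr x y : ovs_le x y = ovs_le 0 (y - x).
Proof. by rewrite /ovs_le -ovs_lt_subr [0 == _]eq_sym subr_eq0 eq_sym. Qed.

Lemma ovs_lexx x : ovs_le x x.
Proof. by rewrite /ovs_le eqxx. Qed.

Lemma ovs_ltW x y : ovs_lt x y -> ovs_le x y.
Proof. by rewrite /ovs_le => ->; rewrite orbT. Qed.

Lemma ovs_le_lt_trans y x z : ovs_le x y -> ovs_lt y z -> ovs_lt x z.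
Proof. by move=> /orP[/eqP->//|]; exact: ovs_lt_trans. Qed.

Lemma ovs_le_trans y x z : ovs_le x y -> ovs_le y z -> ovs_le x z.
Proof.
move=> xy /orP[/eqP<-//|yz]; apply: ovs_ltW; exact: ovs_le_lt_trans xy yz.
Qed.

Lemma ovs_ltNge x y : ovs_lt x y = ~~ ovs_le y x.
Proof.
apply/idP/idP => [xy|].
  by apply/negP => /ovs_le_lt_trans/(_ xy); rewrite ovs_lt_irr.
by rewrite negb_or => /andP[/ovs_lt_total/orP[->|]].
Qed.

Lemma ovs_lt_oppr x : ovs_lt 0 (- x) = ovs_lt x 0.
Proof. by rewrite [RHS]ovs_lt_subr sub0r. Qed.

Lemma ovs_le_opp2 x y : ovs_le (- x) (- y) = ovs_le y x.
Proof. by rewrite ovs_le_subr opprK addrC -ovs_le_subr. Qed.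

Lemma ovs_addr_gt0 x y : ovs_lt 0 x -> ovs_lt 0 y -> ovs_lt 0 (x + y).
Proof.
move=> x0 /(@ovs_lt_add2r _ V _ _ x); rewrite add0r addrC.
exact: ovs_lt_trans.
Qed.

Lemma ovs_addr_ge0 x y : ovs_le 0 x -> ovs_le 0 y -> ovs_le 0 (x + y).
Proof.
move=> /orP[/eqP<-|x0]; rewrite ?add0r// => /orP[/eqP<-|y0].
  by rewrite addr0 ovs_ltW.
by rewrite ovs_ltW ?ovs_addr_gt0.
Qed.

Lemma ovs_scaler_ge0 a x : 0 <= a -> ovs_le 0 x -> ovs_le 0 (a *: x).
Proof.
rewrite le_eqVlt => /orP[/eqP<-|a0]; first by rewrite scale0r ovs_lexx.
move=> /orP[/eqP<-|x0]; first by rewrite scaler0 ovs_lexx.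
by rewrite ovs_ltW// ovs_scale_gt0.
Qed.

Lemma ovs_lt_scale a x y : 0 < a -> ovs_lt x y -> ovs_lt (a *: x) (a *: y).
Proof.
move=> a0; rewrite ovs_lt_subr => xy.
by rewrite ovs_lt_subr -scalerBr ovs_scale_gt0.
Qed.

End OrderedVect.

Section Cone.
Variables (R : realType) (V : lmodType R) (P : pred V).
Hypotheses (P0 : ~~ P 0) (PD : forall x y, P x -> P y -> P (x + y)).
Hypotheses (Ptot : forall x, x != 0 -> P x || P (- x)).
Hypothesis PZ : forall (a : R) x, 0 < a -> P x -> P (a *: x).

Definition cone_lt : rel V := fun x y => P (y - x).

Lemma cone_lt_irr : irreflexive cone_lt.
Proof. by move=> x; rewrite /cone_lt subrr (negbTE P0). Qed.

Lemma cone_lt_trans : transitive cone_lt.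
Proof.
by move=> y x z xy yz; rewrite /cone_lt -(subrKA y) addrC addrC PD// addrC.
Qed.

Lemma cone_lt_total x y : x != y -> cone_lt x y || cone_lt y x.
Proof.
by rewrite eq_sym -subr_eq0 => /Ptot; rewrite /cone_lt opprB.
Qed.

Lemma cone_lt_add2r x y z : cone_lt x y -> cone_lt (x + z) (y + z).
Proof. by rewrite /cone_lt [x + z]addrC addrKA. Qed.

Lemma cone_scale_gt0 (a : R) x : 0 < a -> cone_lt 0 x -> cone_lt 0 (a *: x).
Proof. by rewrite /cone_lt !subr0; exact: PZ. Qed.

Lemma cone_scale_lt0 (a : R) x : 0 < a -> cone_lt x 0 -> cone_lt (a *: x) 0.
Proof. by rewrite /cone_lt !sub0r -scalerN; exact: PZ. Qed.

Definition ovs_of_cone : orderedVect R :=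
  Build_orderedVect cone_lt_irr cone_lt_trans cone_lt_total cone_lt_add2r
    cone_scale_gt0 cone_scale_lt0.

End Cone.

(** * The action of real polynomials on a model *)

Section Induced.
Context {R : realType} {M : ROVSA R}.
Implicit Types (p q h : {poly R}) (x y : M) (a : R).

Lemma inducedE n h x : (size h <= n)%N ->
  induced h x = \sum_(i < n) h`_i *: iter i (sigma M) x.
Proof.
move=> hn; rewrite /induced.
rewrite (big_ord_widen n (fun i => h`_i *: iter i (sigma M) x) hn) big_mkcond.
by apply: eq_bigr => i _; case: ltnP => // /(nth_default 0) ->; rewrite scale0r.
Qed.

Lemma induced_is_linear h : linear (induced h : M -> M).
Proof.
move=> a x y; rewrite scaler_sumr -big_split /=; apply: eq_bigr => i _.
rewrite scalerA mulrC -scalerA -scalerDr; congr (_ *: _).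
by elim: (val i) => //= n ->; rewrite linearP.
Qed.

HB.instance Definition _ h :=
  GRing.isLinear.Build R M M *:%R (induced h : M -> M) (induced_is_linear h).

Lemma inducedD p q x : induced (p + q) x = induced p x + induced q x.
Proof.
pose n := maxn (size p) (size q).
rewrite !(@inducedE n) ?leq_maxl ?leq_maxr ?size_polyD// -big_split /=.
by apply: eq_bigr => i _; rewrite coefD scalerDl.
Qed.

Lemma inducedZ a p x : induced (a *: p) x = a *: induced p x.
Proof.
rewrite (@inducedE (size p)) ?size_scale_leq// scaler_sumr.
by apply: eq_bigr => i _; rewrite coefZ scalerA.
Qed.

Lemma induced0 x : induced 0 x = 0 :> M.
Proof. by rewrite /induced size_poly0 big_ord0. Qed.

Lemma inducedC a x : induced a%:P x = a *: x.
Proof.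
by rewrite (@inducedE 1) ?size_polyC_leq1// big_ord1 coefC.
Qed.

Lemma induced_mulX p x : induced (p * 'X) x = induced p (sigma M x).
Proof.
rewrite (@inducedE (size p).+1); last first.
  by rewrite (leq_trans (size_polyMleq _ _))// size_polyX addn2.
rewrite big_ord_recl coefMX /= scale0r add0r; apply: eq_bigr => i _.
by rewrite coefMX /= -iterSr.
Qed.

Lemma induced_sigma p x : induced p (sigma M x) = sigma M (induced p x).
Proof.
rewrite [in RHS]/induced linear_sum; apply: eq_bigr => i _.
by rewrite linearZ /= -iterSr.
Qed.

Lemma inducedX x : induced 'X x = sigma M x.
Proof. by rewrite -['X]mul1r induced_mulX inducedC scale1r. Qed.

(** A product acts as a composite; this is what lets the factors of a polynomial
be studied separately. *)
Lemma inducedM p q x : induced (p * q) x = induced p (induced q x).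
Proof.
elim/poly_ind: p x => [|p c IH] x; first by rewrite mul0r !induced0.
rewrite mulrDl mul_polyC -mulrA ['X * q]mulrC mulrA !inducedD inducedZ.
by rewrite !induced_mulX inducedC IH induced_sigma.
Qed.

Lemma induced_sigmaV p x : induced p (sigmaV x) = sigmaV (induced p x).
Proof. by rewrite -[in RHS](sigmaVK x) induced_sigma sigmaK. Qed.

End Induced.

(** * Polynomials that induce strictly increasing functions *)

Section Positive.
Variables (R : realType) (M : ROVSA R).
Implicit Types (p q : {poly R}) (x y : M) (a c : R).

Definition positive p := forall x, ovs_lt 0 x -> ovs_lt 0 (induced p x).

Lemma positive_lt p :
  positive p -> {homo (induced p : M -> M) : x y / ovs_lt x y}.
Proof.
move=> pp x y; rewrite ovs_lt_subr => /pp.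
by rewrite linearB /= -ovs_lt_subr.
Qed.

Lemma positive_mono p :
  positive p -> {mono (induced p : M -> M) : x y / ovs_lt x y}.
Proof.
move=> /positive_lt pp x y; apply/idP/idP; last exact: pp.
apply: contraTT; rewrite ovs_ltNge negbK => /orP[/eqP->|/pp yx].
  by rewrite ovs_lt_irr.
by rewrite ovs_ltNge negbK ovs_ltW.
Qed.

Lemma positiveX : positive 'X.
Proof. by move=> x /sigma_lt; rewrite linear0 inducedX. Qed.

Lemma positiveC a : 0 < a -> positive a%:P.
Proof. by move=> a0 x x0; rewrite inducedC ovs_scale_gt0. Qed.

Lemma positiveM p q : positive p -> positive q -> positive (p * q).
Proof. by move=> pp pq x /pq/pp; rewrite inducedM. Qed.

Lemma positive_addl c p q :
  0 <= c -> positive p -> positive q -> positive (p + c%:P * q).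
Proof.
rewrite le_eqVlt => /orP[/eqP<-|c0]; first by rewrite mul0r addr0.
move=> pp pq x x0; rewrite inducedD ovs_addr_gt0 ?pp//.
exact: (positiveM (positiveC c0)).
Qed.

(** A strictly increasing function reflects signs, so the sign of [q(x)] can be
read off from that of [p(q(x))]. *)
Lemma positive_cofactor p q : positive p -> positive (p * q) -> positive q.
Proof.
move=> pp ppq x /ppq; rewrite inducedM.
by rewrite -[X in ovs_lt X _](linear0 (induced p)) positive_mono.
Qed.

(** Write [b = 2 s cos t], so that the complex roots of [X^2 - bX + s^2] have
argument [t] up to sign.  If [b <= 0], the coefficients are nonnegative.
Otherwise multiply by [X^2 + bX + s^2], whose coefficients are nonnegative: the
product is a quadratic polynomial of the same kind in [X^2], with angle [2t], and
[positive_cofactor] applies.  Repeated doubling makes the cosine nonpositive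
after finitely many steps: the normalised gap [(2s - b) / s] at least doubles as
long as [b] is positive, and [n] bounds the number of steps until it reaches
[2].  The variable is a positive polynomial [q] so that the induction can replace
[q] by [q^2]. *)
Lemma positive_quadratic n q (b s : R) : positive q -> 0 < s ->
  2 * s <= 2 ^+ n * (2 * s - b) ->
  positive (q ^+ 2 - b%:P * q + (s ^+ 2)%:P).
Proof.
elim: n q b s => [|n IH] q b s pq s0.
  rewrite expr0 mul1r lerBrDr gerDl => b0.
  rewrite -[X in _ + X]mulr1 addrAC -mulNr -polyCN.
  have s2 : 0 < s ^+ 2 by rewrite exprn_gt0.
  apply: positive_addl; rewrite ?oppr_ge0//.
  apply: positive_addl; rewrite ?ltW//; first exact: positiveM.
  exact: positiveC.
move=> sb; have [b0|b0] := leP b 0.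
  apply: (IH q b s pq s0).
  have : 1 <= 2 ^+ n :> R by rewrite exprn_ege1// ler1n.
  by move: (2 ^+ n : R) => t t1; nra.
have s20 : 0 < s ^+ 2 by rewrite exprn_gt0.
apply: (@positive_cofactor (q ^+ 2 + b%:P * q + (s ^+ 2)%:P)).
  rewrite -[X in _ + X]mulr1; apply: positive_addl; rewrite ?ltW//.
    by apply: positive_addl; rewrite ?ltW//; exact: positiveM.
  exact: positiveC.
have -> : (q ^+ 2 + b%:P * q + (s ^+ 2)%:P) *
    (q ^+ 2 - b%:P * q + (s ^+ 2)%:P)
  = (q ^+ 2) ^+ 2 - (b ^+ 2 - 2 * s ^+ 2)%:P * q ^+ 2 + ((s ^+ 2) ^+ 2)%:P.
  by ring.
apply: IH => //; first exact: positiveM.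
move: sb; rewrite exprS; have : 0 < 2 ^+ n :> R by rewrite exprn_gt0.
move: (2 ^+ n : R) => t t0 sb.
(* The new gap is [(2 s - b) * (2 s + b)], at least [2 s] times the old one. *)
have h1 : s * (2 * s) <= s * (2 * t * (2 * s - b)) by rewrite ler_pM2l.
have h2 : 0 <= 2 * s - b.
  by rewrite leNgt; apply/negP => h; nra.
have h3 : 0 <= t * b * (2 * s - b) by rewrite !mulr_ge0// ltW.
nra.
Qed.

Lemma positive_irreducible_quadratic (a b : R) : b != 0 ->
  positive ('X^2 - (2 * a)%:P * 'X + (a ^+ 2 + b ^+ 2)%:P).
Proof.
move=> b0; pose s := Num.sqrt (a ^+ 2 + b ^+ 2).
have ab0 : a ^+ 2 < a ^+ 2 + b ^+ 2 by rewrite ltrDl exprn_even_gt0.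
have c0 : 0 < a ^+ 2 + b ^+ 2 by apply: le_lt_trans ab0; rewrite sqr_ge0.
have s0 : 0 < s by rewrite sqrtr_gt0.
have sE : s ^+ 2 = a ^+ 2 + b ^+ 2 by rewrite sqr_sqrtr// ltW.
have as_ : a < s by nra.
have [n nP] : exists n, 2 * s <= 2 ^+ n * (2 * s - 2 * a).
  have d0 : 0 < 2 * s - 2 * a by lra.
  exists (Num.truncn (2 * s / (2 * s - 2 * a))).+1.
  rewrite -ler_pdivrMr//; apply: (le_trans (ltW (truncnS_gt _))).
  by rewrite -natrX ler_nat ltnW// ltn_expl.
by rewrite -sE; apply: (positive_quadratic positiveX s0 nP).
Qed.

End Positive.

(** * Factoring a real polynomial *)

(** A nonconstant real polynomial has a complex root [a + bi].  If [b = 0], split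
off [X - a]; otherwise the remainder modulo the real quadratic polynomial with
roots [a + bi] and [a - bi] has degree at most one and vanishes at a nonreal
point, hence is zero. *)
Lemma real_poly_factor (R : rcfType) (h : {poly R}) : (1 < size h)%N ->
  exists q g, [/\ h = q * g, (size g < size h)%N &
    (exists a, q = 'X - a%:P) \/
    (exists a b, b != 0 /\
       q = 'X^2 - (2 * a)%:P * 'X + (a ^+ 2 + b ^+ 2)%:P)].
Proof.
move=> h1.
have cofactor_size (p g : {poly R}) :
    (1 < size p)%N -> h = p * g -> (size g < size h)%N.
  move=> p1 hE; have : h != 0 by rewrite -size_poly_gt0 ltnW.
  rewrite hE mulf_eq0 negb_or => /andP[p0 g0]; rewrite size_mul//.
  by move: p1 (size g); case: (size p) => [|[|m]] // _ k; rewrite ltnS leq_addl.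
pose hC := map_poly (real_complex R) h.
have [|[a b]] := @closed_rootP R[i] hC _; first by rewrite size_map_poly gtn_eqF.
have [->|b0] := eqVneq b 0.
  rewrite fmorph_root => /factor_theorem[g]; rewrite mulrC => hE.
  exists ('X - a%:P), g; split=> //; last by left; exists a.
  by apply: cofactor_size hE; rewrite size_XsubC.
move=> hz; pose q := 'X^2 - (2 * a)%:P * 'X + (a ^+ 2 + b ^+ 2)%:P.
have qm : q = 'X^2 + (- (2 * a) *: 'X + (a ^+ 2 + b ^+ 2)%:P).
  by rewrite /q addrA -mul_polyC polyCN mulNr.
have sq : size q = 3%N.
  rewrite qm size_polyDl size_polyXn// ltnS (leq_trans (size_polyD _ _))//.
  rewrite geq_max (leq_trans (size_scale_leq _ _)) ?size_polyX//=.
  by rewrite (leq_trans (size_polyC_leq1 _)).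
have q0 : q != 0 by rewrite -size_poly_gt0 sq.
suff /eqP r0 : modp h q == 0.
  have hE : h = q * divp h q by rewrite mulrC [LHS](divp_eq h q) r0 addr0.
  exists q, (divp h q); split=> //; last by right; exists a, b.
  by apply: cofactor_size hE; rewrite sq.
have : (size (modp h q) < 3)%N by rewrite -sq ltn_modp.
move: hz; rewrite /hC [in root _ _](divp_eq h q) rmorphD rmorphM /=.
rewrite rootE hornerD hornerM.
have -> : (map_poly (real_complex R) q).[(a +i* b)%C] = 0.
  rewrite /q !(rmorphD, rmorphM, rmorphN) /=.
  rewrite !map_polyC !map_polyX !hornerE /=.
  by apply/eqP; rewrite eq_complex /=; apply/andP; split; apply/eqP; ring.
rewrite mulr0 add0r; move: (modp h q) => r r0 sr.
have [c1 [c0 rE]] : exists c1 c0 : R, r = c1 *: 'X + c0%:P.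
  exists r`_1, r`_0; apply/polyP => -[|[|i]];
    rewrite coefD coefZ coefX coefC /= ?mulr0 ?mulr1 ?addr0 ?add0r//.
  by rewrite nth_default// (leq_trans (_ : _ <= 2)%N).
move: r0; rewrite rE -mul_polyC rmorphD rmorphM /=.
rewrite !map_polyC map_polyX !hornerE /=.
rewrite eq_complex /= => /andP[/eqP e1 /eqP e2].
have {}e2 : c1 * b = 0 by rewrite -[RHS]e2; ring.
have c10 : c1 = 0.
  by apply/eqP; move/eqP: e2; rewrite mulf_eq0 (negbTE b0) orbF.
have c00 : c0 = 0 by rewrite -[RHS]e1 c10; ring.
by rewrite c10 c00 !polyC0 mul0r addr0.
Qed.

(** * Adjoining a solution of [sigma b = a b + z] *)

Section Extension.
Variables (R : realType) (M : ROVSA R).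
Implicit Types (x y l u m : M) (r : R).
Variables (L : M -> Prop) (a : R) (z : M).
Hypothesis Ldown : forall x y, ovs_lt x y -> L y -> L x.
Hypotheses (Lex : exists l, L l) (Uex : exists u, ~ L u).
Hypothesis a_gt0 : 0 < a.
Let T x := a^-1 *: (sigma M x - z).
Hypothesis LT : forall x, L (T x) <-> L x.

(** The pair [(m, r)] stands for [m + r b], where [b] is the new element and
[L] is its lower cut in [M]. *)
Local Notation E := (M * R^o)%type.

Definition affine (v : E) x := v.1 + v.2 *: x.

(** Since [b] lies above every [l] in [L] and below every [u] outside [L],
[m + r b] is positive as soon as it is nonzero and the affine function
[x |-> m + r x] is nonnegative at one such [l] and one such [u].  This
description spares additivity a case distinction on the signs of the coefficients
of [b] in both summands and in their sum, and [sigma]-invariance one on the sign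
of [r].  The inequalities are weak because [L] may have a maximum and
its complement a minimum, while [b] differs from both. *)
Definition cut_cone : pred E := fun v =>
  `[< v <> 0 /\ exists l u,
      [/\ L l, ~ L u, ovs_le 0 (affine v l) & ovs_le 0 (affine v u)] >].

Lemma affine_between v l u x : ovs_le l x -> ovs_le x u ->
  ovs_le 0 (affine v l) -> ovs_le 0 (affine v u) -> ovs_le 0 (affine v x).
Proof.
rewrite [ovs_le l x]ovs_le_subr [ovs_le x u]ovs_le_subr => lx xu vl vu.
case: (leP 0 v.2) => v2.
  have -> : affine v x = affine v l + v.2 *: (x - l).
    by rewrite /affine -addrA -scalerDr [l + _]addrC subrK.
  by rewrite ovs_addr_ge0// ovs_scaler_ge0.
have -> : affine v x = affine v u + (- v.2) *: (u - x).
  by rewrite /affine -addrA scaleNr -scalerN opprB -scalerDr [u + _]addrC subrK.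
by rewrite ovs_addr_ge0// ovs_scaler_ge0// oppr_ge0 ltW.
Qed.

Lemma cut_lt l u : L l -> ~ L u -> ovs_lt l u.
Proof.
move=> Ll Uu; rewrite ovs_ltNge; apply/negP => /orP[/eqP ul|/Ldown/(_ Ll)//].
by apply: Uu; rewrite ul.
Qed.

Lemma cut_cone0 : ~~ cut_cone 0.
Proof. by apply/asboolP => -[]. Qed.

Lemma affineD v w x : affine (v + w) x = affine v x + affine w x.
Proof. by rewrite /affine /= scalerDl addrACA. Qed.

Lemma affineZ r v x : affine (r *: v) x = r *: affine v x.
Proof. by rewrite /affine scalerDr scalerA. Qed.

Lemma affine_eq0 v l u : ovs_lt l u -> affine v l = 0 -> affine v u = 0 -> v = 0.
Proof.
case: v => m r lu; rewrite /affine /= => vl vu.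
have /eqP : r *: (u - l) = 0.
  by rewrite scalerBr -(addrKA m) [_ + m]addrC vu vl subrr.
rewrite scaler_eq0 => /orP[/eqP r0|]; last first.
  by rewrite subr_eq0 => /eqP ul; rewrite ul ovs_lt_irr in lu.
by move: vl; rewrite r0 scale0r addr0 => ->.
Qed.

(** Two positive elements are nonnegative at the ends of a common interval
[[l2, u2]] across the cut.  If their sum were zero, both would vanish at the two
ends, hence be zero. *)
Lemma cut_coneD v w : cut_cone v -> cut_cone w -> cut_cone (v + w).
Proof.
move=> /asboolP[v0 [l [u [Ll Uu vl vu]]]].
move=> /asboolP[w0 [l' [u' [Ll' Uu' wl' wu']]]].
have [l2 [Ll2 ll2 l'l2]] : exists l2, [/\ L l2, ovs_le l l2 & ovs_le l' l2].
  have [ll'|] := boolP (ovs_le l l').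
    by exists l'; split=> //; exact: ovs_lexx.
  by rewrite -ovs_ltNge => /ovs_ltW l'l; exists l; split=> //; exact: ovs_lexx.
have [u2 [Uu2 u2u u2u']] : exists u2, [/\ ~ L u2, ovs_le u2 u & ovs_le u2 u'].
  have [uu'|] := boolP (ovs_le u u').
    by exists u; split=> //; exact: ovs_lexx.
  by rewrite -ovs_ltNge => /ovs_ltW u'u; exists u'; split=> //; exact: ovs_lexx.
have lu := cut_lt Ll2 Uu2.
have btw x : ovs_le l2 x -> ovs_le x u2 ->
    ovs_le 0 (affine v x) /\ ovs_le 0 (affine w x).
  move=> lx xu; split.
    by apply: affine_between vl vu; [exact: ovs_le_trans lx|exact: ovs_le_trans u2u].
  by apply: affine_between wl' wu'; [exact: ovs_le_trans lx|exact: ovs_le_trans u2u'].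
have [vl2 wl2] := btw _ (ovs_lexx l2) (ovs_ltW lu).
have [vu2 wu2] := btw _ (ovs_ltW lu) (ovs_lexx u2).
apply/asboolP; split; last first.
  by exists l2, u2; split=> //; rewrite affineD ovs_addr_ge0.
move=> /eqP; rewrite addr_eq0 => /eqP vw; apply: w0.
have aff0 x : ovs_le 0 (affine v x) -> ovs_le 0 (affine w x) -> affine w x = 0.
  rewrite vw -scaleN1r affineZ scaleN1r => wx0 /orP[/eqP//|wx].
  by move: wx0; rewrite -[ovs_le _ _]negbK -ovs_ltNge -ovs_lt_oppr opprK wx.
by apply: (affine_eq0 lu); exact: aff0.
Qed.

Lemma cut_cone_total v : v != 0 -> cut_cone v || cut_cone (- v).
Proof.
move=> /eqP v0; have Nv0 : - v <> 0 by move/eqP; rewrite oppr_eq0 => /eqP.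
have affineN x : affine (- v) x = - affine v x.
  by rewrite -[- v]scaleN1r affineZ scaleN1r.
have [l [u [Ll Uu vlu]]] : exists l u,
    [/\ L l, ~ L u &
      [\/ affine v l = 0, affine v u = 0 | affine v l = affine v u]].
  have [[l Ll] [u Uu]] := (Lex, Uex).
  have [r0|r0] := eqVneq v.2 0.
    by exists l, u; split=> //; apply: Or33; rewrite /affine r0 !scale0r.
  (* The zero of the affine function is placed at an end of the interval. *)
  pose w := - (v.2^-1 *: v.1).
  have vw : affine v w = 0.
    by rewrite /affine scalerN scalerA divff// scale1r subrr.
  by have [Lw|Uw] := pselect (L w); [exists w, u|exists l, w];
    split=> //; [apply: Or31|apply: Or32].
have coneI w : w <> 0 -> ovs_le 0 (affine w l) -> ovs_le 0 (affine w u) ->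
    cut_cone w.
  by move=> w0 wl wu; apply/asboolP; split=> //; exists l, u.
have le0N x : ovs_le 0 x \/ ovs_le 0 (- x).
  have [|] := boolP (ovs_le 0 x); first by left.
  by rewrite -ovs_ltNge -ovs_lt_oppr => /ovs_ltW; right.
have cv : ovs_le 0 (affine v l) -> ovs_le 0 (affine v u) ->
    cut_cone v || cut_cone (- v).
  by move=> vl vu; rewrite coneI.
have cNv : ovs_le 0 (- affine v l) -> ovs_le 0 (- affine v u) ->
    cut_cone v || cut_cone (- v).
  by move=> vl vu; rewrite (coneI (- v)) ?affineN ?orbT.
have [vl|vl] := le0N (affine v l); have [vu|vu] := le0N (affine v u).
- exact: cv.
- by case: vlu => e; [apply: cNv; rewrite // e oppr0 ovs_lexx|
    apply: cv; rewrite // e ovs_lexx|apply: cv; rewrite // -e].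
- by case: vlu => e; [apply: cv; rewrite // e ovs_lexx|
    apply: cNv; rewrite // e oppr0 ovs_lexx|apply: cv; rewrite // e].
- exact: cNv.
Qed.

Lemma cut_coneZ r v : 0 < r -> cut_cone v -> cut_cone (r *: v).
Proof.
move=> r0 /asboolP[/eqP v0 [l [u [Ll Uu vl vu]]]]; apply/asboolP; split.
  by apply/eqP; rewrite scaler_eq0 negb_or gt_eqF.
by exists l, u; split=> //; rewrite affineZ ovs_scaler_ge0// ltW.
Qed.

Definition cut_ovs : orderedVect R :=
  ovs_of_cone cut_cone0 cut_coneD cut_cone_total cut_coneZ.

Definition cut_sigma (v : E) : E := (sigma M v.1 + v.2 *: z, a * v.2).

Lemma cut_sigma_is_linear : linear cut_sigma.
Proof.
move=> r [m1 r1] [m2 r2]; rewrite /cut_sigma /=; congr (_, _).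
  by rewrite /= linearP scalerDl scalerDr scalerA addrACA.
by rewrite /= /GRing.scale /= mulrDr mulrCA.
Qed.

HB.instance Definition _ :=
  GRing.isLinear.Build R E E *:%R cut_sigma cut_sigma_is_linear.

Definition cut_sigmaV (v : E) : E :=
  (sigmaV (v.1 - (a^-1 * v.2) *: z), a^-1 * v.2).

Lemma cut_sigmaK : cancel cut_sigma cut_sigmaV.
Proof.
move=> [m r]; rewrite /cut_sigma /cut_sigmaV /= mulKf ?gt_eqF//.
by rewrite addrK sigmaK.
Qed.

Lemma cut_sigmaVK : cancel cut_sigmaV cut_sigma.
Proof.
move=> [m r]; rewrite /cut_sigma /cut_sigmaV /= sigmaVK subrK.
by rewrite mulVKf ?gt_eqF.
Qed.

(** The identity [a (T x) + z = sigma x] says that [sigma] carries the value of an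
affine function at [x] to the value of its image at [T x]; so the invariance of
[L] under [T] makes [sigma] preserve positivity. *)
Lemma cut_cone_sigma v : cut_cone v -> cut_cone (cut_sigma v).
Proof.
move=> /asboolP[v0 [l [u [Ll Uu vl vu]]]]; apply/asboolP; split.
  move=> v0'; apply: v0; rewrite -(cut_sigmaK v) v0'.
  by rewrite -[X in cut_sigmaV X](linear0 cut_sigma) cut_sigmaK.
have affineT x : ovs_le 0 (affine v x) -> ovs_le 0 (affine (cut_sigma v) (T x)).
  have -> : affine (cut_sigma v) (T x) = sigma M (affine v x).
    rewrite /affine /T /= scalerA mulrAC divff ?gt_eqF// mul1r.
    rewrite [RHS]linearD [X in _ = _ + X]linearZ /=.
    by rewrite -addrA -scalerDr [z + _]addrC subrK.
  move=> /orP[/eqP<-|/sigma_lt]; first by rewrite linear0 ovs_lexx.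
  by rewrite linear0; exact: ovs_ltW.
by exists (T l), (T u); split; [exact/LT|move/LT|exact: affineT|exact: affineT].
Qed.

Lemma cut_sigma_lt : {homo cut_sigma : x y / cone_lt cut_cone x y}.
Proof. by move=> v w /cut_cone_sigma; rewrite linearB. Qed.

Definition cut_ext : ROVSA R :=
  @Build_ROVSA R cut_ovs (cut_sigma : {linear E -> E}) cut_sigmaV
    cut_sigma_lt cut_sigmaK cut_sigmaVK.

Definition cut_emb_fun (m : M) : E := (m, 0).

Lemma cut_emb_is_linear : linear cut_emb_fun.
Proof. by move=> r m n; congr (_, _); rewrite /= scaler0 addr0. Qed.

HB.instance Definition _ :=
  GRing.isLinear.Build R M E *:%R cut_emb_fun cut_emb_is_linear.

Lemma cut_emb_lt :
  {mono cut_emb_fun : x y / ovs_lt x y >-> cone_lt cut_cone x y}.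
Proof.
have pos x : ovs_lt 0 x -> cut_cone (cut_emb_fun x).
  move=> x0; apply/asboolP; split.
    by case=> xE; rewrite xE ovs_lt_irr in x0.
  have [[l Ll] [u Uu]] := (Lex, Uex).
  by exists l, u; rewrite /affine /= !scale0r addr0 ovs_ltW.
have lt x y : ovs_lt x y -> cone_lt cut_cone (cut_emb_fun x) (cut_emb_fun y).
  by rewrite ovs_lt_subr => /pos; rewrite linearB.
move=> x y; apply/idP/idP; last exact: lt.
apply: contraTT; rewrite ovs_ltNge negbK => /orP[/eqP->|/lt yx].
  by rewrite (cone_lt_irr cut_cone0).
apply/negP => /(cone_lt_trans cut_coneD yx).
by rewrite (cone_lt_irr cut_cone0).
Qed.

Lemma cut_emb_sigma x : cut_emb_fun (sigma M x) = cut_sigma (cut_emb_fun x).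
Proof. by rewrite /cut_sigma /= scale0r addr0 mulr0. Qed.

Lemma cut_emb_sigmaV x : cut_emb_fun (sigmaV x) = cut_sigmaV (cut_emb_fun x).
Proof. by rewrite /cut_sigmaV /= mulr0 scale0r subr0. Qed.

Definition cut_emb : embedding M cut_ext :=
  @Build_embedding R M cut_ext (cut_emb_fun : {linear M -> E})
    (fun x y (e : cut_emb_fun x = cut_emb_fun y) => congr1 fst e)
    cut_emb_lt cut_emb_sigma cut_emb_sigmaV.

Lemma cut_extP p q : L p -> ~ L q -> exists b : cut_ext,
  [/\ ovs_lt (cut_emb p) b, ovs_lt b (cut_emb q) &
     induced ('X - a%:P) b = cut_emb z].
Proof.
move=> Lp Uq; exists ((0, 1) : E); split.
- apply/asboolP; split; first by case=> _ /eqP; rewrite subr0 oner_eq0.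
  exists p, q; split=> //; rewrite /affine /= subr0 scale1r sub0r addrC.
    by rewrite subrr ovs_lexx.
  by rewrite -ovs_le_subr ovs_ltW// cut_lt.
- apply/asboolP; split; first by case=> _ /eqP; rewrite sub0r oppr_eq0 oner_eq0.
  exists p, q; split=> //; rewrite /affine /= subr0 sub0r scaleN1r.
    by rewrite -ovs_le_subr ovs_ltW// cut_lt.
  by rewrite subrr ovs_lexx.
- rewrite inducedD -polyCN inducedC inducedX; congr (_, _).
    by rewrite /= linear0 scale1r add0r scaler0 addr0.
  by rewrite /= /GRing.scale /= !mulr1 addrN.
Qed.

End Extension.

(** * The Intermediate Value Property in existentially closed models *)

Section IVP.
Context {R : realType}.
Implicit Types (h : {poly R}).

Lemma has_IVP_comp (V : orderedVect R) (f g : V -> V) :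
  has_IVP f -> has_IVP g -> has_IVP (f \o g).
Proof. by move=> fI gI A /gI/fI; rewrite image_comp. Qed.

Lemma has_IVP_opp (V : orderedVect R) (f : V -> V) :
  has_IVP f -> has_IVP (fun x => - f x).
Proof.
move=> fI A /fI cA _ _ z [x Ax <-] [y Ay <-] xz zy.
have [||||w Aw fw] := cA (f y) (f x) (- z).
- by exists y.
- by exists x.
- by rewrite -ovs_le_opp2 opprK.
- by rewrite -ovs_le_opp2 opprK.
- by exists w; rewrite // fw opprK.
Qed.

Lemma has_IVP_strict (V : orderedVect R) (f : V -> V) :
  (forall p q z, ovs_lt p q ->
     ovs_lt (f p) z && ovs_lt z (f q) || ovs_lt (f q) z && ovs_lt z (f p) ->
     exists m, [/\ ovs_lt p m, ovs_lt m q & f m = z]) ->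
  has_IVP f.
Proof.
move=> fI A Aconv _ _ z [x Ax <-] [y Ay <-].
move=> /orP[/eqP<- _|xz]; first by exists x.
move=> /orP[/eqP->|zy]; first by exists y.
have [xy|] := eqVneq x y.
  by have := ovs_lt_trans xz zy; rewrite xy ovs_lt_irr.
move=> /ovs_lt_total/orP[xy|yx].
  have [|m [xm my fm]] := fI x y z xy; first by rewrite xz zy.
  by exists m => //; apply: Aconv Ax Ay _ _; exact: ovs_ltW.
have [|m [ym mx fm]] := fI y x z yx; first by rewrite xz zy orbT.
by exists m => //; apply: Aconv Ay Ax _ _; exact: ovs_ltW.
Qed.

(** The cut is the downward closure of the orbit of [p] under [F]: the orbit
increases, and it stays below [q] because [F] moves [q] down. *)
Lemma invariant_cut (V : orderedVect R) (F G : V -> V) (p q : V) :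
  {homo F : x y / ovs_lt x y} -> {homo G : x y / ovs_lt x y} -> cancel F G ->
  ovs_lt p q -> ovs_lt p (F p) -> ovs_lt (F q) q ->
  exists L : V -> Prop, [/\ forall x y, ovs_lt x y -> L y -> L x,
    L p, ~ L q & forall x, L (F x) <-> L x].
Proof.
move=> F_lt G_lt FK pq pFp Fqq.
exists (fun x => exists n, ovs_lt x (iter n F p)); split.
- by move=> x y xy [n yn]; exists n; exact: ovs_lt_trans yn.
(* The zeroth iterate is [p] itself, so strictness calls for the first one. *)
- by exists 1%N.
- move=> [n qn].
  suff : ovs_lt (iter n F p) q by move/(ovs_lt_trans qn); rewrite ovs_lt_irr.
  by elim: {qn}n => //= n /F_lt/ovs_lt_trans; exact.
- move=> x; split=> -[n xn]; last by exists n.+1; exact: F_lt.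
  case: n xn => [/= xp|n /G_lt]; last by rewrite !FK; exists n.
  exists 0%N; rewrite /= -(FK x) -(FK p); apply: G_lt.
  exact: ovs_lt_trans xp pFp.
Qed.

Fixpoint horner_term (X : Type) (s : seq R) (t : term R X) : term R X :=
  if s is c :: s' then TAdd (TScale c t) (horner_term s' (TSigma t))
  else TZero R X.

Lemma eval_horner_term (X : Type) (M : ROVSA R) (e : X -> M) h (t : term R X) :
  eval_term e (horner_term h t) = induced h (eval_term e t).
Proof.
rewrite /induced; elim: {h}(polyseq h) t => [|c s IH] t /=.
  by rewrite big_ord0.
rewrite big_ord_recl IH; congr (_ + _).
by apply: eq_bigr => i _; rewrite -iterSr.
Qed.

(** Existential closedness, applied to the formula
[p < y /\ y < q /\ h(y) = z] with parameters [p], [q], [z]. *)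
Lemma ec_solve (M : ROVSA R) h (p q z : M) : existentially_closed M ->
  (exists (B : ROVSA R) (f : embedding M B) (b : B),
     [/\ ovs_lt (f p) b, ovs_lt b (f q) & induced h b = f z]) ->
  exists m, [/\ ovs_lt p m, ovs_lt m q & induced h m = z].
Proof.
move=> Mec [B [f [b [pb bq hb]]]].
pose x i : term R ('I_3 + 'I_1) := TVar R (inl i).
pose y : term R ('I_3 + 'I_1) := TVar R (inr ord0).
pose phi := FAnd (FAnd (FLt (x 0) y) (FLt y (x 1)))
  (FEq (horner_term h y) (x 2%:R)).
have [|c /= [[pc cq]]] := Mec 3 1 phi [tuple p; q; z].
  by exists B, f, [tuple b]; rewrite /= eval_horner_term.
by rewrite eval_horner_term => hc; exists (tnth c ord0).
Qed.

Variable M : ROVSA R.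
Hypothesis Mec : existentially_closed M.

(** A strictly increasing [h] embeds [M] into itself.  In the target of this
embedding the point [z] lies between the images of [p] and [q], and [h] maps it
to its image: so [z] itself is the solution. *)
Lemma positive_IVP h : positive M h -> has_IVP (induced h : M -> M).
Proof.
move=> hp; apply: has_IVP_strict => p q z pq hz; apply: ec_solve => //.
have {hz}/andP[pz zq] : ovs_lt (induced h p) z && ovs_lt z (induced h q).
  case/orP: hz => // /andP[qz zp].
  have := ovs_lt_trans (ovs_lt_trans qz zp) (positive_lt hp pq).
  by rewrite ovs_lt_irr.
have hmono := positive_mono hp.
have hinj : injective (induced h : M -> M).
  move=> x y hxy; have [//|/ovs_lt_total] := eqVneq x y.
  by rewrite -(hmono x y) -(hmono y x) hxy !ovs_lt_irr.
pose f : embedding M M := @Build_embedding R M M (induced h : {linear M -> M})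
  hinj hmono (fun x => induced_sigma h x) (fun x => induced_sigmaV h x).
by exists M, f, z.
Qed.

(** [h - z] equals [a (T - id)], so [T] moves a point down where [h] is below [z]
and up where [h] is above [z].  If [h] is below [z] at [p], the cut is generated
by the inverse [S] of [T], otherwise by [T]. *)
Lemma linear_IVP a : 0 < a -> has_IVP (induced ('X - a%:P) : M -> M).
Proof.
move=> a0; apply: has_IVP_strict => p q z pq hz; apply: ec_solve => //.
pose T (x : M) := a^-1 *: (sigma M x - z).
pose S (x : M) := sigmaV (a *: x + z).
have hE x : induced ('X - a%:P) x = sigma M x - a *: x.
  by rewrite inducedD -polyCN inducedC inducedX scaleNr.
have TK : cancel T S.
  by move=> x; rewrite /T /S scalerA divff ?gt_eqF// scale1r subrK sigmaK.
have SK : cancel S T.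
  by move=> x; rewrite /T /S sigmaVK addrK scalerA mulVf ?gt_eqF// scale1r.
have T_lt : {homo T : x y / ovs_lt x y}.
  move=> x y /sigma_lt xy.
  by apply: ovs_lt_scale; rewrite ?invr_gt0// ovs_lt_add2r.
have S_lt : {homo S : x y / ovs_lt x y}.
  move=> x y; apply: contraTT; rewrite ovs_ltNge negbK => /orP[/eqP|/T_lt].
    by move=> /(can_inj SK) ->; rewrite ovs_lt_irr.
  by rewrite !SK => yx; rewrite ovs_ltNge negbK ovs_ltW.
have hT x : a^-1 *: (induced ('X - a%:P) x - z) = T x - x.
  by rewrite hE addrAC scalerBr scalerA mulVf ?gt_eqF// scale1r.
have hz_lt x : ovs_lt (induced ('X - a%:P) x) z -> ovs_lt (T x) x.
  move=> xz; rewrite ovs_lt_subr -opprB ovs_lt_oppr -hT.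
  apply: ovs_scale_lt0; rewrite ?invr_gt0//.
  by rewrite -ovs_lt_oppr opprB -ovs_lt_subr.
have hz_gt x : ovs_lt z (induced ('X - a%:P) x) -> ovs_lt x (T x).
  move=> xz; rewrite ovs_lt_subr -hT.
  by apply: ovs_scale_gt0; rewrite ?invr_gt0// -ovs_lt_subr.
suff [L [Ldown Lp Uq LT]] : exists L : M -> Prop,
    [/\ forall x y, ovs_lt x y -> L y -> L x, L p, ~ L q &
        forall x, L (T x) <-> L x].
  have [b bP] :=
    cut_extP Ldown (ex_intro _ p Lp) (ex_intro _ q Uq) a0 LT Lp Uq.
  exact: (ex_intro _ _ (ex_intro _ _ (ex_intro _ b bP))).
case/orP: hz => /andP[].
  move=> /hz_lt/S_lt; rewrite TK => pS /hz_gt/S_lt; rewrite TK => qS.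
  have [L [Ldown Lp Uq LS]] := invariant_cut S_lt T_lt SK pq pS qS.
  by exists L; split=> // x; rewrite -{2}(TK x); apply: iff_sym; exact: LS.
move=> /hz_lt qT /hz_gt pT.
exact: invariant_cut T_lt S_lt TK pq pT qT.
Qed.

End IVP.

Theorem theorem4p5 (R : realType) (h : {poly R}) (M : ROVSA R)
    (M_ec : existentially_closed M) :
  has_IVP (induced h : M -> M).
Proof.
have [n] := ubnP (size h); elim: n h => // n IH h; rewrite ltnS => hn.
have mulI (p q : {poly R}) : has_IVP (induced p : M -> M) ->
    has_IVP (induced q : M -> M) -> has_IVP (induced (p * q) : M -> M).
  move=> pI qI; have -> : induced (p * q) = induced p \o induced q :> (M -> M).
    by apply/funext => x; exact: inducedM.
  exact: has_IVP_comp.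
have [/size1_polyC ->|h1] := leqP (size h) 1.
  move: (h`_0) => c; have [c0|c0|->] := ltgtP c 0.
  - have -> : induced c%:P = (fun x => - induced (- c)%:P x) :> (M -> M).
      by apply/funext => x; rewrite !inducedC scaleNr opprK.
    by apply/has_IVP_opp/positive_IVP => //; apply: positiveC; rewrite oppr_gt0.
  - by apply: positive_IVP => //; exact: positiveC.
  - apply: has_IVP_strict => p q z _; rewrite !inducedC !scale0r orbb.
    by move=> /andP[/ovs_lt_trans h0 /h0]; rewrite ovs_lt_irr.
have [q [g [hE gh qE]]] := real_poly_factor h1; rewrite hE.
apply: mulI; last by apply: IH; exact: leq_trans gh hn.
case: qE => [[a ->]|[a [b [b0 ->]]]]; last first.
  by apply: positive_IVP => //; exact: positive_irreducible_quadratic.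
have [a0|a0] := ltP 0 a; first exact: linear_IVP.
apply: positive_IVP => //; rewrite -polyCN -[X in _ + X]mulr1.
apply: positive_addl; rewrite ?oppr_ge0//; first exact: positiveX.
exact: positiveC.
Qed.
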